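(* Let $j\in k$ be fixed. Consider the graded algebras $\mathcal{E}_\xi$, where $\xi$ ranges over all admissible parameters with $j(E_{\lambda(\xi)})=j$. The number of isomorphism classes (as graded algebras) among these algebras is (i) $3$ when $j\neq 0,12^3$; (ii) $1$ when $j=0$; (iii) $2$ when $j=12^3$.
   Context: Let $k$ be an algebraically closed field of characteristic zero. Call $\xi\in k$ admissible if $\xi\neq 0$, $\xi\neq -2$, $\xi\neq 1\pm\sqrt{-3}$ and $\xi^3\neq 1$. For admissible $\xi$ put $$\mathcal{E}_\xi=k\langle x,y,z\rangle/(xy+yx+\xi z^2,\ yz+zy+\xi x^2,\ zx+xz+\xi y^2),$$ graded by $\deg x=\deg y=\deg z=1$, and $\lambda(\xi)=\frac{2+\xi^3}{3\xi}$. For $\lambda\in k$ with $\lambda^3\neq1$ let $E_\lambda\subset\mathbb{P}^2$ be the elliptic curve $x^3+y^3+z^3-3\lambda xyz=0$, with $j$-invariant $$j(E_\lambda)=\frac{27\lambda^3(\lambda^3+8)^3}{(\lambda^3-1)^3}.$$ For admissible $\xi$ one has $\lambda(\xi)^3\ne 1$. (In terms of geometric algebras, $\mathcal{E}_\xi=\mathcal{A}(E_{\lambda(\xi)},\sigma_{(1:1:\xi)})$, where $\sigma_{(1:1:\xi)}$ is translation by the $2$-torsion point $(1:1:\xi)$ for the group law on $E_{\lambda(\xi)}$ with zero element $(1:-1:0)$.) *)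

(* Defs.v *)
From HB Require Import structures.
From mathcomp Require Import all_boot all_algebra.
From mathcomp Require Import finmap boolp classical_sets cardinality.
From mathcomp.multinomials Require Import monalg.

Set Implicit Arguments.
Unset Strict Implicit.
Unset Printing Implicit Defensive.

Import GRing.Theory.

Local Open Scope classical_set_scope.
Local Open Scope ring_scope.
Local Open Scope quotient_scope.

Definition word (T : Type) := seq T.

Section Word.
Variable T : choiceType.

HB.instance Definition _ := Choice.on (word T).

Lemma cat_unitm (u v : word T) : u ++ v = [::] -> u = [::] /\ v = [::].
Proof. by case: u. Qed.

HB.instance Definition _ := Choice_isMonomialDef.Build (word T)
  (@catA T) (@cat0s T) (@cats0 T) cat_unitm.

End Word.

Definition free_alg (k : nzRingType) (T : choiceType) := {malg k[word T]}.

Section FreeAlg.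
Variables (k : comNzRingType) (T : choiceType).

HB.instance Definition _ := GRing.Lalgebra.on (free_alg k T).

Lemma malgC_comm (c : k) (g : free_alg k T) : malgC c * g = g * malgC c.
Proof.
rewrite !malgM_def fgmulUg fgmulgU; apply: eq_bigr => w _.
by rewrite mul1m mulm1 mulrC.
Qed.

Lemma free_alg_scaleAr (c : k) (g h : free_alg k T) :
  c *: (g * h) = g * (c *: h).
Proof. by rewrite -!(mul_malgC c) !mulrA malgC_comm. Qed.

HB.instance Definition _ :=
  GRing.Lalgebra_isAlgebra.Build k (free_alg k T) free_alg_scaleAr.

Definition free_var (t : T) : free_alg k T := << ([:: t] : word T) >>.

Definition free_homog (n : nat) : set (free_alg k T) :=
  [set g | forall w : word T, w \in msupp g -> size w = n].

End FreeAlg.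

Definition two_sided_ideal (R : nzRingType) (I : set R) : Prop :=
  [/\ I 0,
      forall x y, I x -> I y -> I (x - y),
      forall a x, I x -> I (a * x) &
      forall x a, I x -> I (x * a)].

Section Presented.
Variables (R : nzRingType) (S : set R).

Definition ideal_gen : pred R := fun x =>
  `[< forall I : set R, two_sided_ideal I -> S `<=` I -> I x >].

Lemma ideal_genP x :
  x \in ideal_gen <-> forall I : set R, two_sided_ideal I -> S `<=` I -> I x.
Proof. exact: (iff_sym (rwP (asboolP _))). Qed.

Lemma ideal_gen_zmod_closed : zmod_closed ideal_gen.
Proof.
split=> [|x y /ideal_genP hx /ideal_genP hy]; apply/ideal_genP=> I hI hS.
  by case: hI.
by case: (hI) => _ hB _ _; apply: hB; [apply: hx | apply: hy].
Qed.

HB.instance Definition _ := GRing.isZmodClosed.Build R ideal_gen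
  ideal_gen_zmod_closed.

Lemma ideal_genMl a x : x \in ideal_gen -> a * x \in ideal_gen.
Proof.
move=> /ideal_genP hx; apply/ideal_genP=> I hI hS.
by case: (hI) => _ _ hM _; apply: hM; apply: hx.
Qed.

Lemma ideal_genMr x a : x \in ideal_gen -> x * a \in ideal_gen.
Proof.
move=> /ideal_genP hx; apply/ideal_genP=> I hI hS.
by case: (hI) => _ _ _ hM; apply: hM; apply: hx.
Qed.

Definition ideal_closed : zmodClosed R := GRing.ZmodClosed.clone R ideal_gen _.

Definition presented : Type := Quotient.quot ideal_closed.

HB.instance Definition _ := GRing.Zmodule.on presented.
HB.instance Definition _ := EqQuotient.on presented.

Definition presented_one : presented := \pi_presented 1.
Definition presented_mul (x y : presented) : presented :=
  \pi_presented (repr x * repr y).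

Lemma pi_presentedP (x y : R) :
  \pi_presented x = \pi_presented y <-> x - y \in ideal_gen.
Proof. by rewrite (Quotient.idealrBE ideal_closed); split=> /eqP. Qed.

Lemma pi_presentedD (x y : R) :
  \pi_presented (x + y) = \pi_presented x + \pi_presented y.
Proof. exact: (@pi_addr _ _ _ _ _ (Quotient.quot ideal_closed)). Qed.

Lemma pi_presentedM (x y : R) :
  \pi_presented (x * y) = presented_mul (\pi_presented x) (\pi_presented y).
Proof.
apply/pi_presentedP.
set x' := repr _; set y' := repr _.
have hx : x - x' \in ideal_gen by apply/pi_presentedP; rewrite reprK.
have hy : y - y' \in ideal_gen by apply/pi_presentedP; rewrite reprK.
have -> : x * y - x' * y' = (x - x') * y + x' * (y - y').
  by rewrite mulrBl mulrBr addrA subrK.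
by apply: rpredD; [apply: ideal_genMr | apply: ideal_genMl].
Qed.

Lemma presentedW (P : presented -> Prop) :
  (forall x, P (\pi_presented x)) -> forall x, P x.
Proof. by move=> hP x; rewrite -[x]reprK. Qed.

Lemma presented_mulA : associative presented_mul.
Proof.
elim/presentedW=> x; elim/presentedW=> y; elim/presentedW=> z.
rewrite -(pi_presentedM y z) -(pi_presentedM x y).
by rewrite -(pi_presentedM x) -(pi_presentedM _ z) mulrA.
Qed.

Lemma presented_mul1 : left_id presented_one presented_mul.
Proof. by elim/presentedW=> x; rewrite -(pi_presentedM 1 x) mul1r. Qed.

Lemma presented_mulr1 : right_id presented_one presented_mul.
Proof. by elim/presentedW=> x; rewrite -(pi_presentedM x 1) mulr1. Qed.

Lemma presented_mulDl : left_distributive presented_mul +%R.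
Proof.
elim/presentedW=> x; elim/presentedW=> y; elim/presentedW=> z.
rewrite -(pi_presentedM x z) -(pi_presentedM y z) -(pi_presentedD x y).
by rewrite -(pi_presentedM (x + y)) -pi_presentedD mulrDl.
Qed.

Lemma presented_mulDr : right_distributive presented_mul +%R.
Proof.
elim/presentedW=> x; elim/presentedW=> y; elim/presentedW=> z.
rewrite -(pi_presentedM x y) -(pi_presentedM x z) -(pi_presentedD y z).
by rewrite -(pi_presentedM x (y + z)) -pi_presentedD mulrDr.
Qed.

HB.instance Definition _ := GRing.Zmodule_isPzRing.Build presented
  presented_mulA presented_mul1 presented_mulr1
  presented_mulDl presented_mulDr.

End Presented.

Section PresentedScale.
Variables (k : comNzRingType) (A : algType k) (S : set A).

Definition presented_scale (c : k) (x : presented S) : presented S :=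
  \pi_(presented S) (c *: repr x).

Lemma pi_presentedZ c (x : A) :
  \pi_(presented S) (c *: x) = presented_scale c (\pi_(presented S) x).
Proof.
apply/pi_presentedP; set x' := repr _.
have hx : x - x' \in ideal_gen S by apply/pi_presentedP; rewrite reprK.
by rewrite -scalerBr -[_ - _]mul1r scalerAl ideal_genMl.
Qed.

Lemma presented_scaleA a b x :
  presented_scale a (presented_scale b x) = presented_scale (a * b) x.
Proof.
elim/presentedW: x => x.
by rewrite -(pi_presentedZ b x) -(pi_presentedZ (a * b)) -pi_presentedZ scalerA.
Qed.

Lemma presented_scale1 : left_id 1 presented_scale.
Proof. by elim/presentedW=> x; rewrite -(pi_presentedZ 1 x) scale1r. Qed.

Lemma presented_scaleDr : right_distributive presented_scale +%R.
Proof.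
move=> c; elim/presentedW=> x; elim/presentedW=> y.
rewrite -(pi_presentedZ c x) -(pi_presentedZ c y) -!pi_presentedD.
by rewrite -(pi_presentedZ c (x + y)) scalerDr.
Qed.

Lemma presented_scaleDl x :
  {morph presented_scale^~ x : a b / a + b}.
Proof.
elim/presentedW: x => x a b /=.
rewrite -(pi_presentedZ a x) -(pi_presentedZ b x) -(pi_presentedZ (a + b) x).
by rewrite -pi_presentedD scalerDl.
Qed.

HB.instance Definition _ := GRing.Zmodule_isLmodule.Build k (presented S)
  presented_scaleA presented_scale1 presented_scaleDr presented_scaleDl.

Lemma pi_presented_mul (x y : A) :
  \pi_(presented S) (x * y) = \pi_(presented S) x * \pi_(presented S) y.
Proof. exact: pi_presentedM. Qed.

Lemma pi_presented_scale (c : k) (x : A) :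
  \pi_(presented S) (c *: x) = c *: \pi_(presented S) x.
Proof. exact: pi_presentedZ. Qed.

Lemma presented_scaleAl (c : k) (u v : presented S) :
  c *: (u * v) = (c *: u) * v.
Proof.
elim/presentedW: u => u; elim/presentedW: v => v.
rewrite -(pi_presented_mul u v) -(pi_presented_scale c u).
by rewrite -(pi_presented_scale c (u * v)) -pi_presented_mul scalerAl.
Qed.

Lemma presented_scaleAr (c : k) (u v : presented S) :
  c *: (u * v) = u * (c *: v).
Proof.
elim/presentedW: u => u; elim/presentedW: v => v.
rewrite -(pi_presented_mul u v) -(pi_presented_scale c v).
by rewrite -(pi_presented_scale c (u * v)) -pi_presented_mul scalerAr.
Qed.

End PresentedScale.

Definition graded_iso (k : comNzRingType) (A B : algType k)
    (gA : nat -> set A) (gB : nat -> set B) : Prop :=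
  exists f : {lrmorphism A -> B},
    bijective f /\ forall n, f @` gA n = gB n.

Section Exi.
Variables (k : fieldType) (xi : k).

Local Notation x := (free_var k (0 : 'I_3)).
Local Notation y := (free_var k (1 : 'I_3)).
Local Notation z := (free_var k (2 : 'I_3)).

Definition calE_rels : set (free_alg k 'I_3) :=
  [set x * y + y * x + xi *: z ^+ 2;
       y * z + z * y + xi *: x ^+ 2;
       z * x + x * z + xi *: y ^+ 2].

Definition calE : Type := presented calE_rels.

HB.instance Definition _ := GRing.PzRing.on calE.
HB.instance Definition _ := GRing.Lmodule.on calE.
HB.instance Definition _ := EqQuotient.on calE.

Lemma const_quad (a b c d e : {malg k[word 'I_3]}) :
  a@_mone = 0 -> c@_mone = 0 -> e@_mone = 0 ->
  (a * b + c * d + xi *: e ^+ 2)@_mone = 0.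
Proof.
have cM (u v : {malg k[word 'I_3]}) : (u * v)@_mone = u@_mone * v@_mone.
  exact: rmorphM.
move=> a0 c0 e0; rewrite !mcoeffD mcoeffZ expr2 !cM a0 c0 e0.
by rewrite !mul0r !mulr0 !addr0.
Qed.

Lemma calE_oner_neq0 : (1 : calE) != 0.
Proof.
apply/eqP => h.
have /ideal_genP : (1 - 0 : free_alg k 'I_3) \in ideal_gen calE_rels.
  apply/pi_presentedP; rewrite -/calE.
  by rewrite (@pi_zeror _ _ _ _ _ (Quotient.quot (ideal_closed calE_rels))).
move=> /(_ [set g | g@_(mone (s := word 'I_3)) = 0]) /=.
rewrite subr0 mcoeff1 eqxx => h1; suff /eqP: 1 = 0 :> k by rewrite oner_eq0.
apply: h1.
  split=> [|g g'|a g|g a] /=; first by rewrite mcoeff0.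
  - by move=> e e'; rewrite mcoeffB e e' subr0.
  - by move=> e; rewrite rmorphM /= e mulr0.
  - by move=> e; rewrite rmorphM /= e mul0r.
by move=> g [[->|->]|->]; apply: const_quad; rewrite mcoeffU1.
Qed.

HB.instance Definition _ := GRing.PzSemiRing_isNonZero.Build calE
  calE_oner_neq0.

HB.instance Definition _ := GRing.Lmodule_isLalgebra.Build k calE
  (@presented_scaleAl k _ calE_rels).
HB.instance Definition _ := GRing.Lalgebra_isAlgebra.Build k calE
  (@presented_scaleAr k _ calE_rels).

Definition calE_deg (n : nat) : set calE :=
  \pi_calE @` @free_homog k 'I_3 n.

End Exi.

(* [s] ranges over both square roots of -3. *)
Definition admissible (k : fieldType) (xi : k) : Prop :=
  [/\ xi <> 0, xi <> -2, forall s : k, s ^+ 2 = -3 -> xi <> 1 + s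
    & xi ^+ 3 <> 1].

Definition lambda (k : fieldType) (xi : k) : k := (2 + xi ^+ 3) / (3 * xi).

(* The j-invariant of x^3 + y^3 + z^3 - 3 lam xyz = 0. *)
Definition j_inv (k : fieldType) (lam : k) : k :=
  27 * lam ^+ 3 * (lam ^+ 3 + 8) ^+ 3 / (lam ^+ 3 - 1) ^+ 3.

Definition params (k : fieldType) (j : k) : set k :=
  [set xi | admissible xi /\ j_inv (lambda xi) = j].

Definition calE_iso (k : fieldType) (xi xi' : k) : Prop :=
  @graded_iso k (calE xi) (calE xi') (@calE_deg k xi) (@calE_deg k xi').

(* An isomorphism class is represented by the set of its parameters. *)
Definition iso_classes (k : fieldType) (j : k) : set (set k) :=
  (fun xi => [set xi' | params j xi' /\ calE_iso xi xi']) @` params j.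

(* Main.v *)
Require Import Defs.
From HB Require Import structures.
From mathcomp Require Import all_boot all_algebra ring.
From mathcomp Require Import finmap boolp classical_sets cardinality.
From mathcomp.multinomials Require Import monalg.

(** Index the generators by integers modulo 3. The relations of [calE xi] are
    the symmetric tensors [\sum_(i + j + l = 0) c i j x_i x_j], with
    [c i i = xi] and [c i j = 1] for [i != j]: they span the net of polar
    quadrics of the cubic [F_xi = xi s + 6 p], where [s = x^3 + y^3 + z^3] and
    [p = x y z]. A graded isomorphism [calE xi -> calE xi'] is determined by an
    invertible matrix [T] of its action in degree 1, and the matrices which
    occur are those mapping the first net onto the second one
    ([calE_iso_net_map], [net_map_calE_iso]).

    Such a [T] also maps the cubic [F_xi] to a multiple of [F_xi'], because the
    polar form of [F_xi] is symmetric and [xi'^3 <> 1] ([net_map_cubic]).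
    Hessians are covariant ([hessian_covariant]), the Hessian of a member of
    the Hesse pencil [<s, p>] is again in the pencil, and [F_xi] and its
    Hessian span the pencil since [xi (xi^3 + 8) <> 0]. So [T] acts on the
    whole pencil by a 2 x 2 matrix which commutes, up to a scalar, with the
    Hessian map. Comparing coefficients leaves 12 possibilities up to scale,
    which are the elements of the group generated by [xi |-> e xi], for
    [e^3 = 1], and [xi |-> (xi + 2) / (xi - 1)]. All of them preserve
    [y(xi) = xi^3 (xi^3 + 8)^3 / (xi^3 - 1)^3], so [y(xi) = y(xi')]
    ([net_map_modulus]).

    Conversely, the fibres of [y] are the orbits of this group
    ([hesse_modulus_fibre]), and its generators come from isomorphisms: a
    diagonal substitution ([calE_iso_scale]) and the discrete Fourier transform
    ([calE_iso_fourier]). Hence [calE xi] and [calE xi'] are isomorphic if and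
    only if [y(xi) = y(xi')] ([calE_isoP]).

    Finally [j(E_(lambda xi)) = (y - 16)^3 / y] with [y = y(xi)]
    ([j_inv_hesse_modulus]), and every [y <> 0] is attained
    ([hesse_modulus_surj]). The isomorphism classes therefore correspond to the
    roots of [(y - 16)^3 = j y]. There are three of them, except for [j = 0],
    where 16 is the only root, and for [j = 12^3], where the roots are the
    double root -8 and 64. *)

Set Implicit Arguments.
Unset Strict Implicit.
Unset Printing Implicit Defensive.

Import GRing.Theory.

Local Open Scope ring_scope.
Local Open Scope quotient_scope.

(** * Morphisms out of the free algebra and homogeneous elements *)

Section WordEval.
Variables (R : nzRingType) (T : choiceType) (h : T -> R).

(** The value of a word when the letter [t] is replaced by [h t]. *)
Definition word_eval (w : word T) : R := \prod_(t <- w) h t.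

Lemma word_eval_mmorphism : mmorphism word_eval.
Proof.
split; last by rewrite /word_eval big_nil.
by move=> u v; rewrite /word_eval big_cat.
Qed.

HB.instance Definition _ :=
  isMultiplicative.Build (word T) R word_eval word_eval_mmorphism.

End WordEval.

Section FreeAlgEval.
Variables (k : comNzRingType) (T : choiceType) (A : algType k) (h : T -> A).

(** The algebra morphism out of the free algebra mapping the generator [t] to
    [h t]. *)
Definition free_eval (g : free_alg k T) : A :=
  mmap (in_alg A) (word_eval h) g.

Lemma free_eval_additive : additive free_eval.
Proof. exact: mmap_is_additive. Qed.

HB.instance Definition _ :=
  GRing.isAdditive.Build (free_alg k T) A free_eval free_eval_additive.

Lemma free_eval_multiplicative : multiplicative free_eval.
Proof.
apply: commr_mmap_is_multiplicative => g m m'.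
by rewrite /GRing.comm /= -scalerAl mul1r -scalerAr mulr1.
Qed.

HB.instance Definition _ :=
  GRing.isMultiplicative.Build (free_alg k T) A free_eval
    free_eval_multiplicative.

Lemma free_eval_scalable : scalable free_eval.
Proof.
by move=> c g; rewrite /free_eval mmapZ /= -scalerAl mul1r.
Qed.

HB.instance Definition _ :=
  GRing.isScalable.Build k (free_alg k T) A *:%R free_eval free_eval_scalable.

Lemma free_evalX t : free_eval (free_var k t) = h t.
Proof.
by rewrite /free_eval mmapU /= scale1r mul1r /word_eval big_seq1.
Qed.

End FreeAlgEval.

Section FreeAlgTheory.
Variables (k : comNzRingType) (T : choiceType).
Implicit Types (g : free_alg k T) (w : word T).

Lemma malgU_word w :
  << w >> = \prod_(t <- w) free_var k t :> free_alg k T.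
Proof.
elim: w => [|t w IH]; first by rewrite big_nil.
rewrite big_cons -IH; apply: esym.
by rewrite /free_var malgM_def fgmulUU mul1r.
Qed.

Lemma free_algE g :
  g = \sum_(w <- msupp g) g@_w *: \prod_(t <- w) free_var k t.
Proof.
rewrite {1}(monalgE g); apply: eq_bigr => w _; rewrite -malgU_word.
by apply/malgP => u; rewrite mcoeffZ !mcoeffU mulr_natr.
Qed.

(** A morphism out of the free algebra is determined by the generators. *)
Lemma free_alg_ext (A : algType k) (f1 f2 : {lrmorphism free_alg k T -> A}) :
  (forall t, f1 (free_var k t) = f2 (free_var k t)) -> f1 =1 f2.
Proof.
move=> h g.
have fE (f : {lrmorphism free_alg k T -> A}) :
    f g = \sum_(w <- msupp g) g@_w *: \prod_(t <- w) f (free_var k t).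
  rewrite {1}(free_algE g) linear_sum; apply: eq_bigr => w _.
  by rewrite linearZ rmorph_prod.
rewrite !fE; apply: eq_bigr => w _; congr (_ *: _); exact: eq_bigr.
Qed.

Lemma free_homogD n g1 g2 :
  free_homog n g1 -> free_homog n g2 -> free_homog n (g1 + g2).
Proof.
move=> h1 h2 w /(fsubsetP (msuppD_le _ _)).
by rewrite in_fsetU => /orP[/h1|/h2].
Qed.

Lemma free_homog0 n : @free_homog k T n (0 : free_alg k T).
Proof. by move=> w; rewrite msupp0. Qed.

Lemma free_homogZ n c g : free_homog n g -> free_homog n (c *: g).
Proof. by move=> h w /(fsubsetP (msuppZ_le _ _)) /h. Qed.

Lemma free_homogM m n g1 g2 :
  free_homog m g1 -> free_homog n g2 ->
  free_homog (m + n) (g1 * g2 : free_alg k T).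
Proof.
move=> h1 h2 w /msuppM_le [u [v [/h1 <- /h2 <- ->]]].
exact: size_cat.
Qed.

Lemma free_homog_sum n (I : Type) (r : seq I) (P : pred I)
    (F : I -> free_alg k T) :
  (forall i, P i -> free_homog n (F i)) ->
  @free_homog k T n (\sum_(i <- r | P i) F i).
Proof.
by move=> h; apply: big_ind => //; [exact: free_homog0 | exact: free_homogD].
Qed.

Lemma free_homogX (t : T) : free_homog 1 (free_var k t).
Proof. by move=> w; rewrite /free_var msuppU1 in_fset1 => /eqP ->. Qed.

(** Substituting linear forms for the generators preserves degrees. *)
Lemma free_homog_eval n (h : T -> free_alg k T) g :
  (forall t, free_homog 1 (h t)) -> free_homog n g ->
  free_homog n (free_eval h g).
Proof.
move=> hh hg; rewrite /free_eval mmapE big_seq.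
apply: free_homog_sum => w /hg <-; rewrite /= -scalerAl mul1r.
apply: free_homogZ; rewrite /word_eval; elim: {hg} w => [|t w IH].
  by rewrite big_nil => u; rewrite msuppU1 in_fset1 => /eqP ->.
by rewrite big_cons; apply: (@free_homogM 1 (size w)).
Qed.

End FreeAlgTheory.

Lemma free_homog1E (k : comNzRingType) (T : finType) (g : free_alg k T) :
  free_homog 1 g -> g = \sum_t g@_([:: t] : word T) *: free_var k t.
Proof.
move=> hg; apply/malgP => w; rewrite raddf_sum /=.
have e t : (g@_([:: t] : word T) *: free_var k t)@_w
    = g@_([:: t] : word T) * (([:: t] : word T) == w)%:R.
  by rewrite mcoeffZ mcoeffU1.
under eq_bigr do rewrite e.
have [/hg|hw] := boolP (w \in msupp g).
  case: w {e} => [|t [|? ?]] // _.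
  rewrite (bigD1 t) //= eqxx mulr1 big1 ?addr0 // => u ut.
  by rewrite eqseq_cons (negbTE ut) mulr0.
rewrite (mcoeff_outdom hw) big1 // => t _.
by case: eqP => [->|]; rewrite ?mulr0 // (mcoeff_outdom hw) mul0r.
Qed.

Lemma ord3P (P : 'I_3 -> Prop) : P 0 -> P 1 -> P 2 -> forall i, P i.
Proof.
move=> p0 p1 p2 [[|[|[|//]]] hi].
- by rewrite (_ : Ordinal hi = 0) //; apply: val_inj.
- by rewrite (_ : Ordinal hi = 1) //; apply: val_inj.
- by rewrite (_ : Ordinal hi = 2) //; apply: val_inj.
Qed.

Lemma sum3 (V : nmodType) (F : 'I_3 -> V) : \sum_i F i = F 0 + F 1 + F 2.
Proof.
rewrite !big_ord_recl big_ord0 addr0 addrA.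
by congr (F _ + F _ + F _); apply: val_inj.
Qed.

(** * The relations and the universal property of the algebras *)

Section Quadrics.
Variables (k : fieldType) (xi : k).

(** The coefficient of [x_i x_j] in the only relation of [calE xi] in which
    this monomial occurs. *)
Definition hesse_coef (i j : 'I_3) : k := if i == j then xi else 1.

Lemma hesse_coefC i j : hesse_coef i j = hesse_coef j i.
Proof. by rewrite /hesse_coef eq_sym. Qed.

Lemma hesse_coef_diag i : hesse_coef i i = xi.
Proof. by rewrite /hesse_coef eqxx. Qed.

Lemma hesse_coef_offdiag i j : i != j -> hesse_coef i j = 1.
Proof. by rewrite /hesse_coef => /negbTE ->. Qed.

(** The coefficients of the relation of index [l] of [calE xi]: the monomials
    [x_i x_j] which occur are those with [i + j + l = 0] modulo 3. *)
Definition rel_coef (l i j : 'I_3) : k := (i + j + l == 0)%:R * hesse_coef i j.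

Section Quad.
Variables (A : algType k) (h : 'I_3 -> A).

(** The noncommutative quadratic form with coefficients [G], at [h]. *)
Definition quad (G : 'I_3 -> 'I_3 -> k) : A :=
  \sum_a \sum_b G a b *: (h a * h b).

Lemma quad_relE l :
  quad (rel_coef l) = \sum_i hesse_coef i (- (i + l)) *: (h i * h (- (i + l))).
Proof.
apply: eq_bigr => i _; rewrite (bigD1 (- (i + l))) //= big1 ?addr0.
  by rewrite /rel_coef addrAC subrr eqxx mul1r.
move=> j ji.
by rewrite /rel_coef addrAC addrC addr_eq0 (negbTE ji) mul0r scale0r.
Qed.

Lemma quad_rel0 :
  quad (rel_coef 0) = h 1 * h 2 + h 2 * h 1 + xi *: h 0 ^+ 2.
Proof.
rewrite quad_relE sum3.
have -> : - (0 + 0) = 0 :> 'I_3 by apply: val_inj.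
have -> : - (1 + 0) = 2 :> 'I_3 by apply: val_inj.
have -> : - (2 + 0) = 1 :> 'I_3 by apply: val_inj.
rewrite hesse_coef_diag !hesse_coef_offdiag // !scale1r expr2.
by rewrite -addrA addrC.
Qed.

Lemma quad_rel1 :
  quad (rel_coef 1) = h 2 * h 0 + h 0 * h 2 + xi *: h 1 ^+ 2.
Proof.
rewrite quad_relE sum3.
have -> : - (0 + 1) = 2 :> 'I_3 by apply: val_inj.
have -> : - (1 + 1) = 1 :> 'I_3 by apply: val_inj.
have -> : - (2 + 1) = 0 :> 'I_3 by apply: val_inj.
rewrite hesse_coef_diag !hesse_coef_offdiag // !scale1r expr2.
by rewrite addrC addrA.
Qed.

Lemma quad_rel2 :
  quad (rel_coef 2) = h 0 * h 1 + h 1 * h 0 + xi *: h 2 ^+ 2.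
Proof.
rewrite quad_relE sum3.
have -> : - (0 + 2) = 1 :> 'I_3 by apply: val_inj.
have -> : - (1 + 2) = 0 :> 'I_3 by apply: val_inj.
have -> : - (2 + 2) = 2 :> 'I_3 by apply: val_inj.
by rewrite hesse_coef_diag !hesse_coef_offdiag // !scale1r expr2.
Qed.

End Quad.

Lemma lrmorph_quad (A B : algType k) (f : {lrmorphism A -> B}) (h : 'I_3 -> A) G :
  f (quad h G) = quad (f \o h) G.
Proof.
rewrite /quad linear_sum; apply: eq_bigr => a _; rewrite linear_sum.
by apply: eq_bigr => b _; rewrite linearZ rmorphM.
Qed.

Local Notation X := (@free_var k 'I_3).

Lemma calE_relsE : calE_rels xi = range (fun l => quad X (rel_coef l)).
Proof.
apply/seteqP; split=> [g [[->|->]|->]|g [l _ <-]].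
- by exists 2 => //; exact: quad_rel2.
- by exists 0 => //; exact: quad_rel0.
- by exists 1 => //; exact: quad_rel1.
elim/ord3P: l.
- left; right; exact: quad_rel0.
- right; exact: quad_rel1.
- left; left; exact: quad_rel2.
Qed.

(** The canonical projection of the free algebra onto [calE xi]. *)
Definition calE_pi (g : free_alg k 'I_3) : calE xi := \pi_(calE xi) g.

Lemma calE_pi_additive : additive calE_pi.
Proof.
move=> g1 g2; rewrite /calE_pi (pi_presentedD _ g1 (- g2)); congr (_ + _).
exact: (@pi_oppr _ _ _ _ _ (Quotient.quot (ideal_closed _))).
Qed.

HB.instance Definition _ :=
  GRing.isAdditive.Build (free_alg k 'I_3) (calE xi) calE_pi calE_pi_additive.

Lemma calE_pi_multiplicative : multiplicative calE_pi.
Proof. by split=> // g1 g2; exact: pi_presented_mul. Qed.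

HB.instance Definition _ :=
  GRing.isMultiplicative.Build (free_alg k 'I_3) (calE xi) calE_pi
    calE_pi_multiplicative.

Lemma calE_pi_scalable : scalable calE_pi.
Proof. by move=> c g; exact: pi_presented_scale. Qed.

HB.instance Definition _ :=
  GRing.isScalable.Build k (free_alg k 'I_3) (calE xi) *:%R calE_pi
    calE_pi_scalable.

Lemma calE_piE g1 g2 :
  calE_pi g1 = calE_pi g2 <-> g1 - g2 \in ideal_gen (calE_rels xi).
Proof. exact: pi_presentedP. Qed.

Lemma calE_piP (P : calE xi -> Prop) : (forall g, P (calE_pi g)) -> forall u, P u.
Proof. exact: presentedW. Qed.

Lemma calE_pi_rel l : quad (calE_pi \o X) (rel_coef l) = 0.
Proof.
rewrite -lrmorph_quad -[RHS](raddf0 calE_pi); apply/calE_piE.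
rewrite subr0; apply/ideal_genP => I _; apply; rewrite calE_relsE.
by exists l.
Qed.

Lemma calE_homogP n u :
  calE_deg n u <-> exists2 g, free_homog n g & u = calE_pi g.
Proof. by split=> [[g hg <-]|[g hg ->]]; exists g. Qed.

(** Universal property of [calE xi]. *)
Lemma calE_lift (A : algType k) (h : 'I_3 -> A) :
  (forall l, quad h (rel_coef l) = 0) ->
  exists f : {lrmorphism calE xi -> A}, forall g, f (calE_pi g) = free_eval h g.
Proof.
move=> h0.
have ker g : g \in ideal_gen (calE_rels xi) -> free_eval h g = 0.
  move=> /ideal_genP /(_ (fun g => free_eval h g = 0)); apply.
    split=> [|x y ex ey|a x ex|x a ex]; first exact: raddf0.
    - by rewrite raddfB /= ex ey subr0.
    - by rewrite rmorphM /= ex mulr0.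
    - by rewrite rmorphM /= ex mul0r.
  rewrite calE_relsE => _ [l _ <-]; rewrite lrmorph_quad -[RHS](h0 l).
  by apply: eq_bigr => a _; apply: eq_bigr => b _; rewrite /= !free_evalX.
pose f (u : calE xi) : A := free_eval h (repr u).
have fE g : f (calE_pi g) = free_eval h g.
  apply/eqP; rewrite -subr_eq0 -raddfB; apply/eqP/ker/calE_piE.
  exact: (reprK (calE_pi g)).
have fB : additive f.
  elim/calE_piP=> g1; elim/calE_piP=> g2.
  by rewrite -raddfB !fE raddfB.
have fM : multiplicative f.
  split; last by rewrite -(rmorph1 calE_pi) fE rmorph1.
  elim/calE_piP=> g1; elim/calE_piP=> g2.
  by rewrite -rmorphM !fE rmorphM.
have fZ : scalable f.
  by move=> c; elim/calE_piP=> g; rewrite -linearZ !fE linearZ.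
pose F : {lrmorphism calE xi -> A} :=
  HB.pack f (GRing.isAdditive.Build _ _ f fB)
    (GRing.isMultiplicative.Build _ _ f fM)
    (GRing.isScalable.Build _ _ _ _ f fZ).
by exists F.
Qed.

End Quadrics.

(** The coefficients of the quadratic form [G] after the linear substitution
    [x_i |-> \sum_a T i a x_a]. *)
Definition subst_coef (k : fieldType) (T : 'M[k]_3) (G : 'I_3 -> 'I_3 -> k)
    (a b : 'I_3) : k :=
  \sum_i \sum_j G i j * T i a * T j b.

Section QuadTheory.
Variables (k : fieldType) (A : algType k) (h : 'I_3 -> A).

Lemma quad_ext G1 G2 : (forall a b, G1 a b = G2 a b) -> quad h G1 = quad h G2.
Proof. by move=> e; apply: eq_bigr => a _; apply: eq_bigr => b _; rewrite e. Qed.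

Lemma eq_quad (h' : 'I_3 -> A) G : h =1 h' -> quad h G = quad h' G.
Proof.
by move=> e; apply: eq_bigr => a _; apply: eq_bigr => b _; rewrite !e.
Qed.

Lemma quad_sum (c : 'I_3 -> k) (G : 'I_3 -> 'I_3 -> 'I_3 -> k) :
  quad h (fun a b => \sum_l c l * G l a b) = \sum_l c l *: quad h (G l).
Proof.
under [RHS]eq_bigr do rewrite scaler_sumr.
rewrite exchange_big; apply: eq_bigr => a _.
under [RHS]eq_bigr do rewrite scaler_sumr.
rewrite exchange_big; apply: eq_bigr => b _.
by rewrite scaler_suml; apply: eq_bigr => l _; rewrite scalerA.
Qed.

Lemma quad_subst (T : 'M[k]_3) G :
  quad (fun i => \sum_a T i a *: h a) G = quad h (subst_coef T G).
Proof.
pose t i j a b := (G i j * T i a * T j b) *: (h a * h b).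
transitivity (\sum_i \sum_j \sum_a \sum_b t i j a b).
  apply: eq_bigr => i _; apply: eq_bigr => j _.
  rewrite mulr_suml scaler_sumr; apply: eq_bigr => a _.
  rewrite mulr_sumr scaler_sumr; apply: eq_bigr => b _.
  by rewrite -scalerAl -scalerAr !scalerA.
under eq_bigr => i _ do rewrite exchange_big.
rewrite exchange_big; apply: eq_bigr => a _.
under eq_bigr => i _ do rewrite exchange_big.
rewrite exchange_big; apply: eq_bigr => b _.
rewrite /subst_coef scaler_suml; apply: eq_bigr => i _.
by rewrite scaler_suml.
Qed.

End QuadTheory.

(** [G] is the coefficient matrix of an element of the span of the quadratic
    relations of [calE xi]; [g d] is the coefficient of the relation of index
    [- d]. *)
Definition in_net (k : fieldType) (xi : k) (G : 'I_3 -> 'I_3 -> k) : Prop :=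
  exists g : 'I_3 -> k, forall a b, G a b = g (a + b) * hesse_coef xi a b.

Section QuadRelations.
Variables (k : fieldType) (xi : k).

Local Notation x_ := (fun i => calE_pi xi (free_var k (i : 'I_3))).

Lemma quad_calE_eq0 G : in_net xi G -> quad x_ G = 0.
Proof.
move=> [g gP].
have e a b : G a b = \sum_l g (- l) * rel_coef xi l a b.
  rewrite gP (bigD1 (- (a + b))) //= big1 ?addr0.
    by rewrite /rel_coef subrr eqxx mul1r opprK.
  by move=> l /negbTE; rewrite -addr_eq0 addrC /rel_coef => ->; rewrite mul0r mulr0.
rewrite (quad_ext _ e) quad_sum big1 // => l _.
by rewrite (calE_pi_rel xi l) scaler0.
Qed.

(** Indices of the middle summand of [k + k^3 + k]. *)
Let mid (a : 'I_3) : 'I_5 := lift ord0 (lift ord_max a).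

(** Products of three matrices [test_mx B a] vanish, and products of two of them
    recover the bilinear form [B]: these matrices give a representation of the
    quotient of the free algebra by the quadratic forms orthogonal to [B] and by
    the words of length at least 3. *)
Definition test_mx (B : 'I_3 -> 'I_3 -> k) (a : 'I_3) : 'M[k]_5 :=
  delta_mx ord0 (mid a) + \sum_c B c a *: delta_mx (mid c) ord_max.

Let mid_eq a b : (mid a == mid b) = (a == b).
Proof. by rewrite /mid !(inj_eq lift_inj). Qed.

Let mid_neq0 a : (mid a == ord0) = false. Proof. by []. Qed.

Let mid_neqmax a : (ord_max == mid a) = false.
Proof. by apply/eqP => /(congr1 val) /=; case: a => [[|[|[|]]]]. Qed.

Lemma test_mxM B a b :
  test_mx B a * test_mx B b = B a b *: delta_mx ord0 ord_max.
Proof.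
rewrite /test_mx mulrDl !mulrDr.
rewrite -[X in X + _ + _ = _]/(_ *m _) mul_delta_mx_0 ?mid_neq0 // add0r.
rewrite [X in _ + X]addrC mulr_suml [X in _ + (X + _)]big1 ?add0r; last first.
  move=> c _; rewrite mulr_sumr big1 // => d _.
  rewrite -scalerAl -scalerAr -[X in _ *: (_ *: X)]/(_ *m _).
  by rewrite mul_delta_mx_0 ?mid_neqmax // !scaler0.
rewrite mulr_suml [X in _ + X]big1 ?addr0; last first.
  move=> c _; rewrite -scalerAl -[X in _ *: X]/(_ *m _).
  by rewrite mul_delta_mx_0 ?mid_neqmax // !scaler0.
rewrite mulr_sumr (bigD1 a) //= big1 ?addr0.
  by rewrite -scalerAr -[X in _ *: X]/(_ *m _) mul_delta_mx.
move=> c ca; rewrite -scalerAr -[X in _ *: X]/(_ *m _).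
by rewrite mul_delta_mx_0 ?scaler0 // mid_eq eq_sym.
Qed.

Lemma quad_test_mx B G :
  quad (test_mx B) G = (\sum_a \sum_b G a b * B a b) *: delta_mx ord0 ord_max.
Proof.
rewrite scaler_suml; apply: eq_bigr => a _.
rewrite scaler_suml; apply: eq_bigr => b _.
by rewrite test_mxM scalerA.
Qed.

(** If [B] is orthogonal to the relations, the [test_mx B a] define a
    representation of [calE xi]. *)
Lemma calE_test B : (forall l, \sum_a \sum_b rel_coef xi l a b * B a b = 0) ->
  exists f : {lrmorphism calE xi -> 'M[k]_5}, forall i, f (x_ i) = test_mx B i.
Proof.
move=> hB; case: (@calE_lift _ xi _ (test_mx B)) => [l|f fE].
  by rewrite quad_test_mx hB scale0r.
by exists f => i; rewrite fE free_evalX.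
Qed.

Lemma quad_calE_pairing B G :
  (forall l, \sum_a \sum_b rel_coef xi l a b * B a b = 0) ->
  quad x_ G = 0 -> \sum_a \sum_b G a b * B a b = 0.
Proof.
move=> /calE_test[f fE] /(congr1 f); rewrite lrmorph_quad raddf0.
rewrite (eq_quad _ (h' := test_mx B)) // quad_test_mx => /matrixP.
by move=> /(_ ord0 ord_max); rewrite !mxE !eqxx mulr1.
Qed.

(** The generators of [calE xi] are linearly independent. *)
Lemma calE_gens_free (c : 'I_3 -> k) :
  \sum_i c i *: x_ i = 0 -> forall i, c i = 0.
Proof.
have [l|f fE] := @calE_test (fun _ _ => 0).
  by rewrite big1 // => a _; rewrite big1 // => b _; rewrite mulr0.
have f0 i : f (x_ i) = delta_mx ord0 (mid i).
  by rewrite fE /test_mx big1 ?addr0 // => d _; rewrite scale0r.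
have fZ i : f (c i *: x_ i) = c i *: delta_mx ord0 (mid i).
  by rewrite -f0 linearZ.
move=> /(congr1 f); rewrite raddf0 linear_sum (eq_bigr _ (fun i _ => fZ i)).
move=> /matrixP e i; move: (e ord0 (mid i)); rewrite summxE [RHS]mxE.
rewrite (bigD1 i) //= !mxE !eqxx mulr1 big1 ?addr0 // => j ji.
by rewrite !mxE mid_eq eq_sym (negbTE ji) andbF mulr0.
Qed.

Lemma pairing_delta (G : 'I_3 -> 'I_3 -> k) (c1 c2 : k) (a b a' b' : 'I_3) :
  \sum_i \sum_j G i j *
     (c1 * ((i == a) && (j == b))%:R + c2 * ((i == a') && (j == b'))%:R)
  = c1 * G a b + c2 * G a' b'.
Proof.
have D c p q : \sum_i \sum_j G i j * (c * ((i == p) && (j == q))%:R) = c * G p q.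
  rewrite (bigD1 p) //= [X in _ + X]big1 ?addr0 => [|i /negbTE ip].
    rewrite (bigD1 q) //= big1 ?addr0 => [|j /negbTE jq].
      by rewrite !eqxx mulr1 mulrC.
    by rewrite jq andbF !mulr0.
  by rewrite big1 // => j _; rewrite ip !mulr0.
rewrite -!D -big_split; apply: eq_bigr => i _; rewrite -big_split.
by apply: eq_bigr => j _; rewrite mulrDr.
Qed.

(** The relations of [calE xi] span all its quadratic relations. *)
Lemma quad_calE_in_net G : quad x_ G = 0 -> in_net xi G.
Proof.
move=> G0; exists (fun d => G (1 - d) (2 - d)).
have pair c1 c2 a b a' b' :
    (forall l, c1 * rel_coef xi l a b + c2 * rel_coef xi l a' b' = 0) ->
    c1 * G a b + c2 * G a' b' = 0.
  move=> h; rewrite -pairing_delta; apply: quad_calE_pairing G0 => l.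
  by rewrite pairing_delta.
(* The forms orthogonal to the relations which are used are the antisymmetric
   ones and those comparing the coefficients of x_l^2 and x_(l+1) x_(l+2). *)
have sym a b : G a b = G b a.
  apply/eqP; rewrite -subr_eq0; apply/eqP.
  rewrite -[G a b]mul1r -mulN1r; apply: pair => l.
  by rewrite /rel_coef hesse_coefC (addrC b a) mul1r mulN1r subrr.
have dia l : G l l = xi * G (l + 1) (l + 2).
  apply/eqP; rewrite -subr_eq0; apply/eqP.
  rewrite -[G l l]mul1r -mulNr; apply: pair => m.
  have e : l + 1 + (l + 2) = l + l by apply/eqP; elim/ord3P: l.
  rewrite /rel_coef hesse_coef_diag hesse_coef_offdiag ?e; last by elim/ord3P: l {e}.
  by rewrite mulr1 mul1r mulNr mulrC subrr.
move=> a b /=; have [<-|ab] := eqVneq a b.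
  rewrite hesse_coef_diag mulrC dia; congr (_ * G _ _); apply/eqP; by elim/ord3P: a.
rewrite hesse_coef_offdiag // mulr1.
have [ea|na] := eqVneq a (1 - (a + b)).
  by congr (G _ _) => //; apply/eqP; move: a b ab ea; elim/ord3P; elim/ord3P.
by rewrite sym; congr (G _ _); apply/eqP; move: a b ab na; elim/ord3P; elim/ord3P.
Qed.

End QuadRelations.

(** * Graded isomorphisms and linear maps between nets *)

(** The linear substitution [T] maps the quadratic relations of [calE xi] to
    quadratic relations of [calE xi']. *)
Definition net_map (k : fieldType) (xi xi' : k) (T : 'M[k]_3) : Prop :=
  forall l, in_net xi' (subst_coef T (rel_coef xi l)).

Section NetMaps.
Variable k : fieldType.
Implicit Types (xi : k) (T : 'M[k]_3).

Local Notation X := (@free_var k 'I_3).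
Local Notation lin_form T := (fun i : 'I_3 => \sum_(a : 'I_3) T i a *: X a).

Lemma calE_pi_lin xi T i :
  calE_pi xi (lin_form T i) = \sum_a T i a *: calE_pi xi (X a).
Proof. by rewrite linear_sum; apply: eq_bigr => a _; rewrite linearZ. Qed.

Lemma net_map_hom xi xi' T : net_map xi xi' T ->
  exists f : {lrmorphism calE xi -> calE xi'},
    forall i, f (calE_pi xi (X i)) = \sum_a T i a *: calE_pi xi' (X a).
Proof.
move=> hT.
have [l|f fE] := @calE_lift _ xi (calE xi') (calE_pi xi' \o lin_form T).
  rewrite (eq_quad _ (calE_pi_lin xi' T)) quad_subst.
  exact/quad_calE_eq0/hT.
by exists f => i; rewrite fE free_evalX /= calE_pi_lin.
Qed.

Lemma calE_ext xi (A : algType k) (f1 f2 : {lrmorphism calE xi -> A}) :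
  (forall i, f1 (calE_pi xi (X i)) = f2 (calE_pi xi (X i))) -> f1 =1 f2.
Proof.
move=> h; elim/calE_piP=> g.
exact: (@free_alg_ext _ _ _ (f1 \o calE_pi xi) (f2 \o calE_pi xi)).
Qed.

Lemma calE_hom_homog xi xi' T (f : {lrmorphism calE xi -> calE xi'}) n u :
  (forall i, f (calE_pi xi (X i)) = \sum_a T i a *: calE_pi xi' (X a)) ->
  calE_deg n u -> calE_deg n (f u).
Proof.
move=> fE /calE_homogP[g hg ->]; apply/calE_homogP.
exists (free_eval (lin_form T) g).
  apply: free_homog_eval hg => i.
  by apply: free_homog_sum => a _; apply/free_homogZ/free_homogX.
apply: (@free_alg_ext _ _ _ (f \o calE_pi xi)
          (calE_pi xi' \o free_eval (lin_form T))) => i /=.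
by rewrite fE free_evalX calE_pi_lin.
Qed.

Lemma linear_lincomb (A B : lmodType k) (f : {linear A -> B}) (c : 'I_3 -> k)
    (u : 'I_3 -> A) (T : 'M[k]_3) (v : 'I_3 -> B) :
  (forall i, f (u i) = \sum_a T i a *: v a) ->
  f (\sum_i c i *: u i) = \sum_a (\sum_i c i * T i a) *: v a.
Proof.
move=> h; rewrite linear_sum.
under [RHS]eq_bigr => a _ do rewrite scaler_suml.
rewrite exchange_big; apply: eq_bigr => i _.
rewrite linearZ /= h scaler_sumr; apply: eq_bigr => a _.
by rewrite scalerA.
Qed.

Lemma sum_delta_scale (A : lmodType k) (c : 'I_3 -> k) (v : 'I_3 -> A) i :
  (forall b, c b = (i == b)%:R) -> \sum_b c b *: v b = v i.
Proof.
move=> cE; rewrite (bigD1 i) //= cE eqxx scale1r big1 ?addr0 // => b bi.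
by rewrite cE eq_sym (negbTE bi) scale0r.
Qed.

Lemma net_map_calE_iso xi xi' T T' : T *m T' = 1%:M ->
  net_map xi xi' T -> net_map xi' xi T' -> calE_iso xi xi'.
Proof.
move=> TT' /net_map_hom[f fE] /net_map_hom[g gE].
have comp xi1 xi2 T1 T2 (f1 : {lrmorphism calE xi1 -> calE xi2})
    (f2 : {lrmorphism calE xi2 -> calE xi1}) : T1 *m T2 = 1%:M ->
    (forall i, f1 (calE_pi xi1 (X i)) = \sum_a T1 i a *: calE_pi xi2 (X a)) ->
    (forall i, f2 (calE_pi xi2 (X i)) = \sum_a T2 i a *: calE_pi xi1 (X a)) ->
    cancel f1 f2.
  move=> T12 f1E f2E; apply: (@calE_ext _ _ (f2 \o f1) idfun) => i /=.
  transitivity (f2 (\sum_a T1 i a *: calE_pi xi2 (X a))).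
    exact: congr1 (f1E i).
  transitivity (\sum_b (\sum_a T1 i a * T2 a b) *: calE_pi xi1 (X b)).
    exact: linear_lincomb.
  apply: sum_delta_scale => b.
  have := congr1 (fun M : 'M_3 => M i b) T12.
  by rewrite !mxE => <-.
have fK : cancel f g by exact: comp TT' fE gE.
have gK : cancel g f by apply: comp gE fE; exact: mulmx1C.
exists f; split; first exact: (Bijective fK gK).
move=> n; apply/seteqP; split=> [_ [u hu <-]|u hu].
  exact: calE_hom_homog fE hu.
exists (g u); [exact: calE_hom_homog gE hu | exact: gK].
Qed.

Lemma calE_iso_net_map xi xi' :
  calE_iso xi xi' -> exists2 T, T \in unitmx & net_map xi xi' T.
Proof.
move=> [f [bf fdeg]].
have ex i : exists r : 'rV[k]_3,
    f (calE_pi xi (X i)) = \sum_a r 0 a *: calE_pi xi' (X a).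
  have : calE_deg 1 (f (calE_pi xi (X i))).
    rewrite -fdeg; exists (calE_pi xi (X i)) => //.
    apply/calE_homogP; exists (X i) => //; exact: free_homogX.
  case/calE_homogP => g hg ->; exists (\row_a g@_([:: a] : word 'I_3)).
  rewrite {1}(free_homog1E hg) linear_sum; apply: eq_bigr => a _.
  by rewrite linearZ mxE.
have [r rE] := choice ex.
pose T : 'M[k]_3 := \matrix_(i, a) r i 0 a.
have TE i : f (calE_pi xi (X i)) = \sum_a T i a *: calE_pi xi' (X a).
  by rewrite rE; apply: eq_bigr => a _; rewrite mxE.
exists T; last first.
  move=> l; apply: quad_calE_in_net.
  rewrite -quad_subst; transitivity (f (quad (calE_pi xi \o X) (rel_coef xi l))).
    apply: etrans (esym (lrmorph_quad f _ _)).
    apply: eq_quad => i; exact: esym (TE i).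
  exact: etrans (congr1 f (calE_pi_rel xi l)) (raddf0 f).
(* A row vector killed by T gives a linear relation between the images of the
   generators under the injective morphism f. *)
rewrite -row_free_unit -kermx_eq0; apply/rowV0P => v /sub_kermxP vT.
have v0 : \sum_i v 0 i *: calE_pi xi (X i) = 0.
  apply: (bij_inj bf); rewrite raddf0 (linear_lincomb _ TE) big1 // => a _.
  have := congr1 (fun M : 'rV_3 => M 0 a) vT.
  by rewrite !mxE => ->; rewrite scale0r.
by apply/rowP => i; rewrite mxE (calE_gens_free v0).
Qed.

End NetMaps.

Lemma calE_iso_trans (k : fieldType) (xi1 xi2 xi3 : k) :
  calE_iso xi1 xi2 -> calE_iso xi2 xi3 -> calE_iso xi1 xi3.
Proof.
move=> [f [bf hf]] [g [bg hg]].
exists (g \o f); split; first exact: (bij_comp bg bf).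
move=> n; apply: etrans (hg n); apply: etrans _ (congr1 (image^~ g) (hf n)).
exact/esym/image_comp.
Qed.

(** * Cubics of the Hesse pencil and their Hessians *)

Lemma det3 (R : comNzRingType) (M : 'M[R]_3) :
  \det M = M 0 0 * (M 1 1 * M 2 2 - M 1 2 * M 2 1)
         - M 0 1 * (M 1 0 * M 2 2 - M 1 2 * M 2 0)
         + M 0 2 * (M 1 0 * M 2 1 - M 1 1 * M 2 0).
Proof.
rewrite (expand_det_row _ 0) sum3 /cofactor.
have d2 (N : 'M[R]_2) : \det N = N 0 0 * N 1 1 - N 0 1 * N 1 0.
  rewrite (expand_det_row _ 0) !big_ord_recl big_ord0 /cofactor !det_mx11 !mxE.
  rewrite /= !expr0 expr1.
  rewrite (_ : lift 0 0 = 1 :> 'I_2); last exact: val_inj.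
  rewrite (_ : lift 1 0 = 0 :> 'I_2); last exact: val_inj.
  ring.
rewrite !d2 !mxE /=.
rewrite (_ : lift 0 0 = 1 :> 'I_3); last exact: val_inj.
rewrite (_ : lift 0 1 = 2 :> 'I_3); last exact: val_inj.
rewrite (_ : lift 1 0 = 0 :> 'I_3); last exact: val_inj.
rewrite (_ : lift 1 1 = 2 :> 'I_3); last exact: val_inj.
rewrite (_ : lift 2 0 = 0 :> 'I_3); last exact: val_inj.
rewrite (_ : lift 2 1 = 1 :> 'I_3); last exact: val_inj.
rewrite !expr0 !expr1 /=; ring.
Qed.

Section HessePencil.
Variables (k : fieldType) (k_char0 : [pchar k] =i pred0).
Implicit Types (a b c xi : k) (u v w : 'cV[k]_3) (T : 'M[k]_3).

Lemma nat_neq0 n : n.+1%:R != 0 :> k.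
Proof. by rewrite ((pcharf0P k).1 k_char0). Qed.

Definition sum_cubes u : k := u 0 0 ^+ 3 + u 1 0 ^+ 3 + u 2 0 ^+ 3.
Definition prod_coords u : k := u 0 0 * u 1 0 * u 2 0.

(** The cubics of the Hesse pencil. *)
Definition hesse_cubic a b u := a * sum_cubes u + 6 * b * prod_coords u.

(** The polar form of [hesse_cubic a b]: the symmetric trilinear form which
    restricts to it on the diagonal. *)
Definition hesse_polar a b u v w : k :=
  a * (u 0 0 * v 0 0 * w 0 0 + u 1 0 * v 1 0 * w 1 0 + u 2 0 * v 2 0 * w 2 0)
  + b * (u 0 0 * (v 1 0 * w 2 0 + v 2 0 * w 1 0)
       + u 1 0 * (v 0 0 * w 2 0 + v 2 0 * w 0 0)
       + u 2 0 * (v 0 0 * w 1 0 + v 1 0 * w 0 0)).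

Lemma hesse_polarC a b u v w : hesse_polar a b u v w = hesse_polar a b v u w.
Proof. by rewrite /hesse_polar; ring. Qed.

Lemma hesse_polarCr a b u v w : hesse_polar a b u v w = hesse_polar a b u w v.
Proof. by rewrite /hesse_polar; ring. Qed.

Lemma polarization a b u v w : 6 * hesse_polar a b u v w =
  hesse_cubic a b (u + v + w) - hesse_cubic a b (u + v) - hesse_cubic a b (v + w)
  - hesse_cubic a b (u + w)
  + hesse_cubic a b u + hesse_cubic a b v + hesse_cubic a b w.
Proof.
by rewrite /hesse_cubic /hesse_polar /sum_cubes /prod_coords !mxE; ring.
Qed.

(** The matrix of second derivatives of [hesse_cubic a b] at [u], divided by
    6; its determinant is the Hessian up to a constant. *)
Definition hesse_mx a b u : 'M[k]_3 :=
  \matrix_(i, j) hesse_polar a b u (delta_mx i 0) (delta_mx j 0).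

Lemma det_hesse_mx a b u : \det (hesse_mx a b u) =
  (a ^+ 3 + 2 * b ^+ 3) * prod_coords u - a * b ^+ 2 * sum_cubes u.
Proof.
rewrite det3 /hesse_mx !mxE /hesse_polar !mxE /= /sum_cubes /prod_coords.
ring.
Qed.

Lemma hesse_mx_conj a b u T :
  T^T *m hesse_mx a b u *m T =
  \matrix_(i, j) hesse_polar a b u (col i T) (col j T).
Proof.
apply/matrixP => i j; rewrite !mxE sum3 !mxE !sum3 !mxE.
rewrite /hesse_polar !mxE /=; ring.
Qed.

(** The Hessian is a covariant of cubics. *)
Lemma hessian_covariant a b a' b' T :
  (forall u, hesse_cubic a b (T *m u) = hesse_cubic a' b' u) -> forall u,
  \det T ^+ 2 * \det (hesse_mx a b (T *m u)) = \det (hesse_mx a' b' u).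
Proof.
move=> hT u.
have polarT v w : hesse_polar a b (T *m u) (T *m v) (T *m w)
    = hesse_polar a' b' u v w.
  apply: (mulfI (nat_neq0 5)); rewrite !polarization -!mulmxDr !hT //.
have <- : T^T *m hesse_mx a b (T *m u) *m T = hesse_mx a' b' u.
  apply/matrixP => i j; rewrite hesse_mx_conj !mxE -polarT.
  by rewrite -!colE.
by rewrite !det_mulmx det_tr; ring.
Qed.

Lemma hesse_cubic_mulmx a b T u : let c i := col i T in
  hesse_cubic a b (T *m u) =
    hesse_polar a b (c 0) (c 0) (c 0) * u 0 0 ^+ 3
  + hesse_polar a b (c 1) (c 1) (c 1) * u 1 0 ^+ 3
  + hesse_polar a b (c 2) (c 2) (c 2) * u 2 0 ^+ 3
  + 3 * hesse_polar a b (c 1) (c 0) (c 0) * u 1 0 * u 0 0 ^+ 2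
  + 3 * hesse_polar a b (c 2) (c 0) (c 0) * u 2 0 * u 0 0 ^+ 2
  + 3 * hesse_polar a b (c 0) (c 1) (c 1) * u 0 0 * u 1 0 ^+ 2
  + 3 * hesse_polar a b (c 2) (c 1) (c 1) * u 2 0 * u 1 0 ^+ 2
  + 3 * hesse_polar a b (c 0) (c 2) (c 2) * u 0 0 * u 2 0 ^+ 2
  + 3 * hesse_polar a b (c 1) (c 2) (c 2) * u 1 0 * u 2 0 ^+ 2
  + 6 * hesse_polar a b (c 0) (c 1) (c 2) * u 0 0 * u 1 0 * u 2 0.
Proof.
rewrite /= /hesse_cubic /sum_cubes /prod_coords /hesse_polar !mxE !sum3.
ring.
Qed.

Lemma polar_subst_coef xi T d i j :
  hesse_polar xi 1 (col d T) (col i T) (col j T) =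
  \sum_l T l d * subst_coef T (rel_coef xi l) i j.
Proof.
rewrite /hesse_polar !mxE sum3 /subst_coef !sum3 /rel_coef /hesse_coef /=.
ring.
Qed.

(** If [T] pulls the net of polar quadrics of [F_xi] back to that of [F_xi'], it
    pulls the cubic [F_xi] back to a multiple of [F_xi']. This fails for
    [xi'^3 = 1], when [F_xi'] is a sum of three cubes of linear forms and its net
    is also the net of other such sums. *)
Lemma net_map_cubic xi xi' T : xi' ^+ 3 <> 1 -> net_map xi xi' T ->
  exists c, forall u, hesse_cubic xi 1 (T *m u) = c * hesse_cubic xi' 1 u.
Proof.
move=> xi1 /choice[g gP].
pose N d m := \sum_l T l d * g l m.
have P d i j : hesse_polar xi 1 (col d T) (col i T) (col j T)
    = N d (i + j) * hesse_coef xi' i j.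
  rewrite polar_subst_coef /N mulr_suml; apply: eq_bigr => l _.
  by rewrite gP mulrA.
(* The left-hand side of P is symmetric in d, i, j. This forces N d m to vanish
   unless d + m = 0, and the three remaining values to be equal. *)
have Pd d i : i != d -> N d (i + i) * xi' = N i (i + d).
  move=> di; have := P i i d; rewrite hesse_coef_offdiag // mulr1 => <-.
  by rewrite hesse_polarCr hesse_polarC P hesse_coef_diag.
have z (x y z : k) : x * xi' = y -> y * xi' = z -> z * xi' = x -> x = 0.
  move=> <- <- e; apply/eqP; move: e => /eqP.
  rewrite -subr_eq0 (_ : _ - x = x * (xi' ^+ 3 - 1)); last by ring.
  by rewrite mulf_eq0 subr_eq0 => /orP[//|/eqP].
have i11 : 1 + 1 = 2 :> 'I_3 by exact: val_inj.
have i12 : 1 + 2 = 0 :> 'I_3 by exact: val_inj.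
have i21 : 2 + 1 = 0 :> 'I_3 by exact: val_inj.
have i22 : 2 + 2 = 1 :> 'I_3 by exact: val_inj.
have N10 := Pd 1 0 isT; have N02 := Pd 0 2 isT; have N21 := Pd 2 1 isT.
have N20 := Pd 2 0 isT; have N01 := Pd 0 1 isT; have N12 := Pd 1 2 isT.
rewrite !(add0r, addr0, i11, i12, i21, i22) in N10 N02 N21 N20 N01 N12.
have z10 := z _ _ _ N10 N02 N21; have z20 := z _ _ _ N20 N01 N12.
have z01 : N 0 1 = 0 by rewrite -N10 z10 mul0r.
have z02 : N 0 2 = 0 by rewrite -N20 z20 mul0r.
have z22 : N 2 2 = 0 by rewrite -N02 z01 mul0r.
have z11 : N 1 1 = 0 by rewrite -N01 z02 mul0r.
have s1 : N 1 2 = N 0 0.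
  have := P 0 1 2; rewrite hesse_polarC P !hesse_coef_offdiag // !mulr1.
  by rewrite add0r i12.
have s2 : N 2 1 = N 0 0.
  have := P 0 1 2; rewrite hesse_polarCr hesse_polarC P !hesse_coef_offdiag //.
  by rewrite !mulr1 add0r i12.
exists (N 0 0) => u; rewrite hesse_cubic_mulmx /= !P !hesse_coef_diag.
rewrite hesse_coef_offdiag // !(add0r, addr0, i11, i12, i21, i22).
rewrite s1 s2 z10 z20 z01 z02 z11 z22.
rewrite /hesse_cubic /sum_cubes /prod_coords; ring.
Qed.

Lemma cubic_form_eq0 (c0 c1 c2 c3 : k) :
  (forall a b, c0 * a ^+ 3 + c1 * a ^+ 2 * b + c2 * a * b ^+ 2 + c3 * b ^+ 3 = 0) ->
  [/\ c0 = 0, c1 = 0, c2 = 0 & c3 = 0].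
Proof.
move=> h; have h0 := h 1 0; have h3 := h 0 1.
have e0 : c0 = 0 by rewrite -h0; ring.
have e3 : c3 = 0 by rewrite -h3; ring.
have e2 : c2 = 0.
  apply: (mulfI (nat_neq0 1)); rewrite mulr0.
  by rewrite -[RHS](addr0 0) -(congr2 +%R (h 1 1) (h 1 (-1))) e0 e3; ring.
by split=> //; rewrite -[RHS](h 1 1) e0 e2 e3; ring.
Qed.

(** The modulus of the cubic [hesse_cubic xi 1], normalised as
    [27 * 16^3] divided by its j-invariant. *)
Definition hesse_modulus xi := xi ^+ 3 * (xi ^+ 3 + 8) ^+ 3 / (xi ^+ 3 - 1) ^+ 3.

Lemma hesse_modulus_moebius xi : xi ^+ 3 <> 1 ->
  hesse_modulus ((xi + 2) / (xi - 1)) = hesse_modulus xi.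
Proof.
move=> xi1.
have q0 : xi ^+ 3 - 1 != 0 by rewrite subr_eq0; apply/eqP.
have qE : xi ^+ 3 - 1 = (xi - 1) * (xi ^+ 2 + xi + 1) by ring.
have [p0 p1] : xi - 1 != 0 /\ xi ^+ 2 + xi + 1 != 0.
  by apply/andP; rewrite -negb_or -mulf_eq0 -qE.
have r0 : (xi + 2) ^+ 3 - (xi - 1) ^+ 3 != 0.
  rewrite (_ : _ - _ = 9 * (xi ^+ 2 + xi + 1)); last by ring.
  by rewrite mulf_neq0 // (nat_neq0 8).
by rewrite /hesse_modulus; field; rewrite q0 p0 mulN1r r0.
Qed.

Lemma hesse_modulus_cube xi xi' : xi ^+ 3 = xi' ^+ 3 ->
  hesse_modulus xi = hesse_modulus xi'.
Proof. by rewrite /hesse_modulus => ->. Qed.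

(** Here [(a, b) |-> (a', b')] is the action of a linear map on the Hesse
    pencil, and [D] is the square of the determinant of this linear map. The
    last hypothesis expresses the covariance of the Hessian, which is
    [(a^3 + 2 b^3) p - a b^2 s] for the cubic [a s + 6 b p]. *)
Lemma pencil_map_modulus xi xi' c D m11 m12 m21 m22 :
  xi ^+ 3 <> 1 -> D != 0 -> (m11, m21) != (0, 0) -> (m12, m22) != (0, 0) ->
  c * xi' = m11 * xi + m12 -> c = m21 * xi + m22 ->
  (forall a b, let a' := m11 * a + m12 * b in let b' := m21 * a + m22 * b in
     D * ((a ^+ 3 + 2 * b ^+ 3) * m12 - 6 * a * b ^+ 2 * m11)
       = - 6 * a' * b' ^+ 2 /\
     D * ((a ^+ 3 + 2 * b ^+ 3) * m22 - 6 * a * b ^+ 2 * m21)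
       = a' ^+ 3 + 2 * b' ^+ 3) ->
  hesse_modulus xi = hesse_modulus xi'.
Proof.
move=> xi1 D0 m1 m2 cx ce H.
have [e1 e2 e3 e4] : [/\ D * m12 + 6 * m11 * m21 ^+ 2 = 0,
   6 * m12 * m21 ^+ 2 + 12 * m11 * m21 * m22 = 0,
   - 6 * D * m11 + 6 * m11 * m22 ^+ 2 + 12 * m12 * m21 * m22 = 0
   & 2 * D * m12 + 6 * m12 * m22 ^+ 2 = 0].
  apply: cubic_form_eq0 => a b; have [/= /eqP h _] := H a b.
  by move: h; rewrite -subr_eq0 => /eqP <-; ring.
have [f1 f2 f3 f4] : [/\ D * m22 - m11 ^+ 3 - 2 * m21 ^+ 3 = 0,
   - 3 * m11 ^+ 2 * m12 - 6 * m21 ^+ 2 * m22 = 0,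
   - 6 * D * m21 - 3 * m11 * m12 ^+ 2 - 6 * m21 * m22 ^+ 2 = 0
   & 2 * D * m22 - m12 ^+ 3 - 2 * m22 ^+ 3 = 0].
  apply: cubic_form_eq0 => a b; have [_ /= /eqP h] := H a b.
  by move: h; rewrite -subr_eq0 => /eqP <-; ring.
have n0 := nat_neq0.
(* If m12 = 0 the matrix is diagonal, and xi'^3 = xi^3. *)
have [m12_0|m12_0] := eqVneq m12 0.
  have m22_0 : m22 != 0 by apply: contraNneq m2 => ->; rewrite m12_0.
  have m21_0 : m21 = 0.
    apply/eqP; apply: contraNT m22_0 => m21_0.
    have m11_0 : m11 = 0.
      apply/eqP; move/eqP: e1; rewrite m12_0 mulr0 add0r !mulf_eq0.
      by rewrite (negbTE m21_0) (negbTE (n0 5)) !orbF /=.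
    have DE : D = - m22 ^+ 2.
      apply: (mulfI (n0 5)); apply: (mulIf m21_0); apply/eqP.
      by rewrite -subr_eq0 -oppr_eq0 -f3 m11_0 m12_0; apply/eqP; ring.
    have : 4 * m22 ^+ 3 = 0 by rewrite -[RHS]oppr0 -f4 m12_0 DE; ring.
    by move=> /eqP; rewrite mulf_eq0 expf_eq0 (negbTE (n0 3)).
  have m11_0 : m11 != 0 by apply: contraNneq m1 => ->; rewrite m21_0.
  have DE : D = m22 ^+ 2.
    apply: (mulfI (n0 5)); apply: (mulIf m11_0); apply/eqP.
    by rewrite -subr_eq0 -oppr_eq0 -e3 m21_0; apply/eqP; ring.
  have m3 : m11 ^+ 3 = m22 ^+ 3.
    by apply/eqP; rewrite -subr_eq0 -oppr_eq0 -f1 m21_0 DE; apply/eqP; ring.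
  apply: hesse_modulus_cube; apply: (mulfI (expf_neq0 3 m22_0)).
  rewrite -[in LHS]m3 -!exprMn; congr (_ ^+ 3).
  transitivity (c * xi'); first by rewrite cx m12_0; ring.
  by rewrite ce m21_0; ring.
(* Otherwise xi' = e (f xi + 2) / (f xi - 1) for the cube roots of unity
   e = - m12 / (2 m22) and f = - m21 / m22. *)
have DE : D = - 3 * m22 ^+ 2.
  apply: (mulfI (n0 1)); apply: (mulIf m12_0); apply/eqP.
  by rewrite -subr_eq0 -e4; apply/eqP; ring.
have m22_0 : m22 != 0.
  by apply: contraNneq D0 => h; rewrite DE h; apply/eqP; ring.
have m21_0 : m21 != 0.
  apply/eqP => h; move/eqP: e1.
  by rewrite h expr0n /= mulr0 addr0 mulf_eq0 (negbTE D0) (negbTE m12_0).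
have m11E : m11 = - (m12 * m21) / (2 * m22).
  apply: (mulfI (n0 11)); apply: (mulIf m21_0); apply: (mulIf m22_0).
  apply/eqP; rewrite -subr_eq0 -e2; apply/eqP; field.
  by rewrite m22_0 (n0 1).
pose f := - m21 / m22; pose e := - m12 / (2 * m22).
have f1' : f ^+ 3 = 1.
  apply: (mulfI (mulf_neq0 (n0 2) (mulf_neq0 m12_0 (expf_neq0 2 m22_0)))).
  apply/eqP; rewrite -subr_eq0 -e1 DE m11E /f; apply/eqP; field.
  by rewrite m22_0 (n0 1).
have e1' : e ^+ 3 = 1.
  apply: (mulfI (mulf_neq0 (n0 7) (expf_neq0 3 m22_0))).
  apply/eqP; rewrite -subr_eq0 -f4 DE /e; apply/eqP; field.
  by rewrite m22_0 (n0 1).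
have fx1 : (f * xi) ^+ 3 <> 1 by rewrite exprMn f1' mul1r.
have fx0 : f * xi - 1 != 0.
  by rewrite subr_eq0; apply/eqP => h; apply: fx1; rewrite h expr1n.
have -> : hesse_modulus xi = hesse_modulus (f * xi).
  by apply: hesse_modulus_cube; rewrite exprMn f1' mul1r.
rewrite -hesse_modulus_moebius //; apply: hesse_modulus_cube.
have -> : xi' = e * ((f * xi + 2) / (f * xi - 1)).
  apply: (mulfI fx0); apply: (mulfI m22_0).
  transitivity (- (c * xi')); first by rewrite ce /f; field.
  rewrite cx m11E /e /f; field.
  have -> : - m21 * xi + -1 * m22 = m22 * (f * xi - 1) by rewrite /f; field.
  by rewrite mulf_neq0 ?m22_0 ?(n0 1).
by rewrite [RHS]exprMn e1' mul1r.
Qed.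

(** A linear isomorphism of nets preserves the modulus. *)
Lemma net_map_modulus xi xi' T : xi <> 0 -> xi ^+ 3 <> -8 -> xi ^+ 3 <> 1 ->
  xi' ^+ 3 <> 1 -> T \in unitmx -> net_map xi xi' T ->
  hesse_modulus xi = hesse_modulus xi'.
Proof.
move=> xi0 xi8 xi1 xi'1 uT /(net_map_cubic xi'1)[c cE].
have D0 : \det T ^+ 2 != 0 by rewrite expf_neq0 // -unitfE -unitmxE.
move/eqP in xi0; move/eqP in xi8.
have {}xi8 : xi ^+ 3 + 8 != 0 by rewrite addr_eq0.
have hE u : hesse_cubic xi 1 (T *m u) = hesse_cubic (c * xi') c u.
  by rewrite cE /hesse_cubic; ring.
have HE := hessian_covariant hE.
(* Since xi != 0 and xi^3 + 8 != 0, the cubic F_xi and its Hessian span the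
   pencil, so that both p o T and s o T belong to it. *)
pose d := (\det T ^+ 2)^-1.
have pE u : 6 * prod_coords (T *m u) =
   (6 * (c - d * c ^+ 3) * xi' / (xi ^+ 3 + 8)) * sum_cubes u
 + 6 * ((6 * c + d * c ^+ 3 * (xi' ^+ 3 + 2)) / (xi ^+ 3 + 8)) * prod_coords u.
  have e1 := hE u; have := HE u; rewrite !det_hesse_mx => e2.
  have e3 : (xi ^+ 3 + 2) * prod_coords (T *m u) - xi * sum_cubes (T *m u)
      = d * c ^+ 3 * ((xi' ^+ 3 + 2) * prod_coords u - xi' * sum_cubes u).
    apply: (mulfI D0); rewrite -(mulrA d) (mulrA _ d) mulfV // mul1r.
    by apply: etrans (etrans _ e2) _; ring.
  apply: (mulIf xi8).
  transitivity (6 * ((xi ^+ 3 + 2) * prod_coords (T *m u)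
     - xi * sum_cubes (T *m u)) + 6 * hesse_cubic xi 1 (T *m u)).
    by rewrite /hesse_cubic; ring.
  by rewrite e3 e1 /hesse_cubic; field.
set m12 := 6 * _ * xi' / _ in pE; set m22 := (_ + _) / _ in pE.
have sE u : sum_cubes (T *m u) =
   ((c * xi' - m12) / xi) * sum_cubes u + 6 * ((c - m22) / xi) * prod_coords u.
  apply: (mulIf xi0).
  transitivity (hesse_cubic xi 1 (T *m u) - 6 * prod_coords (T *m u)).
    by rewrite /hesse_cubic; ring.
  by rewrite pE hE /hesse_cubic; field.
set m11 := _ / xi in sE; set m21 := _ / xi in sE.
have FE a b u : hesse_cubic a b (T *m u)
    = hesse_cubic (m11 * a + m12 * b) (m21 * a + m22 * b) u.
  transitivity (a * sum_cubes (T *m u) + b * (6 * prod_coords (T *m u))).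
    by rewrite /hesse_cubic; ring.
  by rewrite sE pE /hesse_cubic; ring.
pose v : 'cV[k]_3 := const_mx 1.
pose e : 'cV[k]_3 := delta_mx 0 0.
have sv : sum_cubes v = 3 by rewrite /sum_cubes !mxE !expr1n; ring.
have pv : prod_coords v = 1 by rewrite /prod_coords !mxE !mulr1.
have se : sum_cubes e = 1 by rewrite /sum_cubes !mxE /=; ring.
have pe : prod_coords e = 0 by rewrite /prod_coords !mxE /=; ring.
(* Coefficients in the pencil are compared at e, where s = 1 and p = 0, and at
   v, where s = 3 and p = 1. *)
apply: (@pencil_map_modulus _ _ c (\det T ^+ 2) m11 m12 m21 m22) => //.
- apply/eqP => -[m11_0 m21_0]; have := sE (invmx T *m e).
  rewrite mulKVmx // se m11_0 m21_0 => /eqP.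
  by rewrite mulr0 !mul0r addr0 oner_eq0.
- apply/eqP => -[m12_0 m22_0]; have := pE (invmx T *m v).
  rewrite mulKVmx // pv m12_0 m22_0 => /eqP.
  by rewrite mulr0 !mul0r addr0 mulr1 (negbTE (nat_neq0 5)).
- by rewrite /m11; field.
- by rewrite /m21; field.
move=> a b /=; have He := hessian_covariant (FE a b) e.
have Hv := hessian_covariant (FE a b) v.
rewrite !det_hesse_mx in He Hv.
have pEe := pE e; have pEv := pE v.
rewrite !(sE, se, sv, pe, pv) in He Hv pEe pEv.
set P := prod_coords (T *m e) in He pEe.
set Q := prod_coords (T *m v) in Hv pEv.
have m12E : m12 = 6 * P by rewrite pEe; ring.
have m22E : 6 * m22 = 6 * Q - 18 * P.
  have -> : 18 * P = 3 * (6 * P) by ring.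
  by rewrite pEv pEe; ring.
split.
  rewrite [in LHS]m12E.
  by apply: etrans (etrans _ (congr1 ( *%R 6) He)) _; ring.
apply: (mulfI (nat_neq0 5)).
apply: etrans (etrans _ (congr2 (fun x y => 6 * x - 18 * y) Hv He)) _; last first.
  by rewrite /=; ring.
transitivity (\det T ^+ 2 * ((a ^+ 3 + 2 * b ^+ 3) * (6 * m22)
   - 36 * a * b ^+ 2 * m21)); first by ring.
rewrite m22E; ring.
Qed.

End HessePencil.

(** * Isomorphisms given by diagonal and Fourier matrices *)

Lemma net_map_scale (k : fieldType) (xi xi' : k) (T : 'M[k]_3) (s : k) :
  net_map xi xi' T -> net_map xi xi' (s *: T).
Proof.
move=> hT l; have [g gE] := hT l.
exists (fun d => s ^+ 2 * g d) => a b; rewrite -mulrA -gE /subst_coef mulr_sumr.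
apply: eq_bigr => i _; rewrite mulr_sumr; apply: eq_bigr => j _.
rewrite !mxE; ring.
Qed.

Section ScaleIso.
Variable k : fieldType.

(** The diagonal matrix with entries [1], [1], [c]. *)
Definition diag11 (c : k) : 'M[k]_3 :=
  \matrix_(i, j) (if i == j then if i == 2 then c else 1 else 0).

Lemma net_map_diag (xi xi' c : k) : c * xi' = xi -> c ^+ 2 * xi = xi' ->
  net_map xi xi' (diag11 c).
Proof.
move=> h1 h2 l.
exists (fun d => if d + l == 0 then if l == 2 then 1 else c else 0).
move: l; elim/ord3P; elim/ord3P; elim/ord3P;
  rewrite /subst_coef !sum3 /rel_coef /hesse_coef !mxE /=;
  first [ring | transitivity xi; [ring | by rewrite h1]
       | transitivity (c ^+ 2 * xi); [ring | rewrite h2; ring]].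
Qed.

Lemma calE_iso_scale (xi e : k) : e ^+ 3 = 1 -> calE_iso xi (e * xi).
Proof.
move=> e3; apply: (@net_map_calE_iso _ _ _ (diag11 (e ^+ 2)) (diag11 e)).
- apply/matrixP; elim/ord3P; elim/ord3P; rewrite !mxE sum3 !mxE /=;
    first [ring | rewrite -e3; ring].
- apply: net_map_diag.
    by rewrite mulrA -exprSr e3 mul1r.
  by rewrite -exprM (exprD e 1 3) e3 expr1 mulr1.
apply: net_map_diag => //.
by rewrite mulrA -exprSr e3 mul1r.
Qed.

End ScaleIso.

Section FourierIso.
Variables (k : fieldType) (k_char0 : [pchar k] =i pred0).
Variables (w : k) (w2 : w ^+ 2 = - 1 - w).

(** The three cube roots of unity, indexed modulo 3. *)
Definition root3 (i : 'I_3) : k :=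
  if i == 0 then 1 else if i == 1 then w else - 1 - w.

(** The discrete Fourier transform modulo 3, and three times its inverse. *)
Definition fourier_mx : 'M[k]_3 := \matrix_(i, j) root3 (i * j).
Definition fourier_mx' : 'M[k]_3 := \matrix_(i, j) root3 (- (i * j)).

Lemma fourier_mxM : fourier_mx *m fourier_mx' = 3%:M.
Proof.
apply/matrixP; elim/ord3P; elim/ord3P; rewrite !mxE sum3 !mxE /root3 /=;
  ring: w2.
Qed.

Lemma net_map_fourier (xi : k) : xi != 1 ->
  net_map xi ((xi + 2) / (xi - 1)) fourier_mx.
Proof.
rewrite -subr_eq0 => xi1 l.
exists (fun d => (xi - 1) * root3 (l * d)).
move: l; elim/ord3P; elim/ord3P; elim/ord3P;
  rewrite /subst_coef !sum3 /rel_coef /hesse_coef !mxE /root3 /=;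
  field: w2; by rewrite ?xi1.
Qed.

Lemma net_map_fourier' (xi : k) : xi != 1 ->
  net_map xi ((xi + 2) / (xi - 1)) fourier_mx'.
Proof.
rewrite -subr_eq0 => xi1 l.
exists (fun d => (xi - 1) * root3 (- (l * d))).
move: l; elim/ord3P; elim/ord3P; elim/ord3P;
  rewrite /subst_coef !sum3 /rel_coef /hesse_coef !mxE /root3 /=;
  field: w2; by rewrite ?xi1.
Qed.

Lemma calE_iso_fourier (xi : k) : xi != 1 ->
  calE_iso xi ((xi + 2) / (xi - 1)).
Proof.
move=> xi1.
have n3 : 3 != 0 :> k := nat_neq0 k_char0 2.
apply: (@net_map_calE_iso _ _ _ fourier_mx (3^-1 *: fourier_mx')).
- by rewrite -scalemxAr fourier_mxM scale_scalar_mx mulVf.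
- exact: net_map_fourier.
have d0 : xi - 1 != 0 by rewrite subr_eq0.
have m1 : (xi + 2) / (xi - 1) != 1.
  apply/eqP => /(congr1 ( *%R^~ (xi - 1))); rewrite mulfVK // mul1r.
  by move=> /addrI /eqP; rewrite -subr_eq0 opprK -natr1 addrC natr1 (negbTE n3).
(* xi |-> (xi + 2) / (xi - 1) is an involution. *)
apply: net_map_scale; move: (net_map_fourier' m1).
have <- : xi = ((xi + 2) / (xi - 1) + 2) / ((xi + 2) / (xi - 1) - 1).
  field; rewrite d0 (_ : xi + 2 + -1 * (xi - 1) = 3) ?n3 //; ring.
by [].
Qed.

(** Two points with the same modulus are in the same orbit of the group generated
    by [xi |-> e xi], with [e] a cube root of unity, and
    [xi |-> (xi + 2) / (xi - 1)]; the last factor [e] is hidden by taking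
    cubes. *)
Lemma hesse_modulus_fibre (xi xi' : k) : xi ^+ 3 <> 1 -> xi' ^+ 3 <> 1 ->
  hesse_modulus xi = hesse_modulus xi' ->
  xi' ^+ 3 = xi ^+ 3 \/
  exists2 f, f ^+ 3 = 1 & xi' ^+ 3 = ((f * xi + 2) / (f * xi - 1)) ^+ 3.
Proof.
move=> xi1 xi'1 e.
have {}xi1 : xi ^+ 3 - 1 != 0 by rewrite subr_eq0; apply/eqP.
have {}xi'1 : xi' ^+ 3 - 1 != 0 by rewrite subr_eq0; apply/eqP.
(* As a polynomial in xi'^3, the difference of the two moduli has the root
   xi^3 and the roots ((f xi + 2) / (f xi - 1))^3 with f^3 = 1. *)
pose P f := xi' ^+ 3 * (f * xi - 1) ^+ 3 - (f * xi + 2) ^+ 3.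
have /eqP : (xi ^+ 3 - xi' ^+ 3) * (P 1 * P w * P (- 1 - w)) = 0.
  transitivity ((xi ^+ 3 - 1) ^+ 3 * (xi' ^+ 3 - 1) ^+ 3 *
                (hesse_modulus xi - hesse_modulus xi')).
    by rewrite /P /hesse_modulus; field: w2; rewrite xi1 xi'1.
  by rewrite e subrr mulr0.
rewrite mulf_eq0 subr_eq0 => /orP[/eqP ->|]; first by left.
have w3 : w ^+ 3 = 1 by ring: w2.
have v3 : (- 1 - w) ^+ 3 = 1 by ring: w2.
rewrite !mulf_eq0 => Pf; right.
have [f f3 Pf0] : exists2 f, f ^+ 3 = 1 & P f = 0.
  by case/orP: Pf => [/orP[]|] /eqP h; [exists 1 | exists w | exists (- 1 - w)];
     rewrite ?expr1n.
have fx : f * xi - 1 != 0.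
  apply: contraNneq xi1 => /eqP; rewrite subr_eq0 => /eqP h.
  by rewrite subr_eq0 -[X in _ == X](expr1n _ 3) -h exprMn f3 mul1r.
exists f => //; rewrite expr_div_n; apply: (canRL (mulfK (expf_neq0 3 fx))).
by apply/eqP; rewrite -subr_eq0; apply/eqP.
Qed.

End FourierIso.

(** * The classification and the number of isomorphism classes *)

Section Classification.
Variables (k : closedFieldType) (k_char0 : [pchar k] =i pred0).
Implicit Types xi : k.

Let n0 := nat_neq0 k_char0.

Lemma cube_root_exists (t : k) : exists x : k, x ^+ 3 = t.
Proof.
have [x e] := solve_monicpoly (fun i => if i == 0%N then t else 0) (isT : 0 < 3)%N.
by exists x; rewrite e !big_ord_recl big_ord0 /=; ring.
Qed.

Lemma primitive_root3_exists : exists w : k, w ^+ 2 = - 1 - w.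
Proof.
have [w e] := solve_monicpoly (fun _ => - 1 : k) (isT : 0 < 2)%N.
by exists w; rewrite e !big_ord_recl big_ord0 /=; ring.
Qed.

(** The excluded values [-2] and [1 + s], with [s^2 = -3], are the cube roots of
    [-8]. *)
Lemma admissibleP xi :
  admissible xi <-> [/\ xi <> 0, xi ^+ 3 <> - 8 & xi ^+ 3 <> 1].
Proof.
split=> [[xi0 xi2 xis xi1]|[xi0 xi8 xi1]]; split=> //.
- move=> xi8; have /eqP : (xi + 2) * (xi ^+ 2 - 2 * xi + 4) = 0.
    rewrite [LHS](_ : _ = xi ^+ 3 + 8); last by ring.
    by rewrite xi8 addNr.
  rewrite mulf_eq0 addr_eq0 => /orP[/eqP //|/eqP h].
  apply: (xis (xi - 1)); last by rewrite addrC subrK.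
  by rewrite -[RHS]add0r -h; ring.
- by move=> h; apply: xi8; rewrite h; ring.
- by move=> s s2 h; apply: xi8; rewrite h; ring: s2.
Qed.

(** The modulus is a complete invariant of the graded algebra [calE xi]. *)
Lemma calE_isoP xi xi' : admissible xi -> admissible xi' ->
  calE_iso xi xi' <-> hesse_modulus xi = hesse_modulus xi'.
Proof.
move=> /admissibleP[xi0 xi8 xi1] /admissibleP[xi'0 xi'8 xi'1]; split.
  by case/calE_iso_net_map => T uT hT; apply: net_map_modulus uT hT.
have [w w2] := primitive_root3_exists.
have iso_cube (x x' : k) : x <> 0 -> x' ^+ 3 = x ^+ 3 -> calE_iso x x'.
  move=> /eqP x0 e; rewrite (_ : x' = x' / x * x); last by rewrite divfK.
  by apply: calE_iso_scale; rewrite expr_div_n e divff // expf_neq0.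
case/(hesse_modulus_fibre w2 xi1 xi'1) => [|[f f3]]; first exact: iso_cube.
set xf := f * xi => e.
apply: (@calE_iso_trans _ _ xf); first exact: calE_iso_scale.
have xf1 : xf != 1.
  by apply/eqP => h; apply: xi1; rewrite -[LHS]mul1r -f3 -exprMn -/xf h expr1n.
apply: calE_iso_trans (calE_iso_fourier k_char0 w2 xf1) _.
apply: (iso_cube _ _ _ e) => h; apply: xi'0.
have /eqP : xi' ^+ 3 = 0 by rewrite e h expr0n.
by rewrite expf_eq0 => /eqP.
Qed.

Lemma j_inv_hesse_modulus xi : admissible xi ->
  j_inv (lambda xi) = (hesse_modulus xi - 16) ^+ 3 / hesse_modulus xi.
Proof.
move=> /admissibleP[/eqP xi0 /eqP xi8 /eqP xi1].
rewrite -subr_eq0 opprK in xi8; rewrite -subr_eq0 in xi1.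
rewrite /j_inv /lambda /hesse_modulus; field.
rewrite xi1 xi8 xi0 (n0 2) /=.
have -> : (2 + xi ^+ 3) ^+ 3 + -1 * (27 * xi ^+ 3)
    = (xi ^+ 3 - 1) ^+ 2 * (xi ^+ 3 + 8) by ring.
exact: mulf_neq0 (expf_neq0 2 xi1) xi8.
Qed.

Lemma hesse_modulus_neq0 xi : admissible xi -> hesse_modulus xi != 0.
Proof.
move=> /admissibleP[/eqP xi0 /eqP xi8 /eqP xi1].
rewrite -subr_eq0 opprK in xi8; rewrite -subr_eq0 in xi1.
apply: mulf_neq0; first by apply: mulf_neq0; exact: expf_neq0.
by rewrite invr_eq0; exact: expf_neq0.
Qed.

Lemma hesse_modulus_surj (y : k) : y != 0 ->
  exists2 xi, admissible xi & hesse_modulus xi = y.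
Proof.
move=> y0.
have [t te] : exists t : k, t * (t + 8) ^+ 3 = y * (t - 1) ^+ 3.
  have [t e] := solve_monicpoly (fun i => nth 0
    [:: - y; 3 * y - 512; - (3 * y) - 192; y - 24] i) (isT : 0 < 4)%N.
  exists t; apply/eqP; rewrite -subr_eq0; apply/eqP.
  move: e; rewrite !big_ord_recl big_ord0 /= /bump /= => /eqP.
  by rewrite -subr_eq0 => /eqP <-; ring.
have [xi e] := cube_root_exists t; rewrite -e in te.
have adm : admissible xi.
  apply/admissibleP; split=> h.
  - move/eqP: te; rewrite h expr0n /= mul0r eq_sym mulf_eq0 (negbTE y0) /=.
    by rewrite expf_eq0 /= sub0r oppr_eq0 oner_eq0.
  - move/eqP: te; rewrite h addNr expr0n /= mulr0 eq_sym mulf_eq0 (negbTE y0) /=.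
    by rewrite expf_eq0 /= (_ : - 8 - 1 = - 9) ?oppr_eq0 ?(negbTE (n0 8)) //; ring.
  - move/eqP: te; rewrite h subrr expr0n /= mulr0 mul1r expf_eq0 /=.
    by rewrite (_ : 1 + 8 = 9) ?(negbTE (n0 8)) //; ring.
exists xi => //; case/admissibleP: adm => _ _ /eqP xi1.
by rewrite /hesse_modulus te mulfK // expf_neq0 // subr_eq0.
Qed.

(** The values of [hesse_modulus] on [params j], as shown by [params_moduli] and
    [moduli_params]. *)
Definition moduli (j : k) : set k := [set y | (y - 16) ^+ 3 = j * y].

Lemma params_moduli (j : k) xi : params j xi -> moduli j (hesse_modulus xi).
Proof.
move=> [adm <-]; rewrite /moduli /= j_inv_hesse_modulus // divfK //.
exact: hesse_modulus_neq0.
Qed.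

Lemma moduli_params (j y : k) :
  moduli j y -> exists2 xi, params j xi & hesse_modulus xi = y.
Proof.
rewrite /moduli /= => yj; have y0 : y != 0.
  apply/eqP => h; move/eqP: yj; rewrite h mulr0 sub0r.
  by rewrite expf_eq0 oppr_eq0 (negbTE (n0 15)).
have [xi a e] := hesse_modulus_surj y0.
by exists xi => //; split=> //; rewrite j_inv_hesse_modulus // e yj mulfK.
Qed.

(** The parameters in [params j] of modulus [y]. *)
Definition modulus_class (j y : k) : set k :=
  [set xi | params j xi /\ hesse_modulus xi = y].

Lemma iso_classesE (j : k) : iso_classes j = (modulus_class j @` moduli j)%classic.
Proof.
have classE xi : params j xi ->
    [set xi' | params j xi' /\ calE_iso xi xi']%classic
    = modulus_class j (hesse_modulus xi).
  move=> [a _]; apply/seteqP; split=> xi' [p h]; split=> //; have [a' _] := p.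
    exact/esym/(calE_isoP a a').
  exact/(calE_isoP a a')/esym.
apply/seteqP; split=> [_ [xi pxi <-]|_ [y /moduli_params[xi pxi <-] <-]].
  exists (hesse_modulus xi); first exact: params_moduli.
  exact/esym/classE.
by exists xi; rewrite ?classE.
Qed.

Lemma modulus_class_inj (j : k) : {in moduli j &, injective (modulus_class j)}.
Proof.
move=> y y' /[!inE] /moduli_params[xi pxi <-] _ e.
by have [] : modulus_class j y' xi by rewrite -e.
Qed.

Lemma card_seq (T : choiceType) (s : seq T) : uniq s ->
  ([set x | x \in s] #= `I_(size s))%card.
Proof.
move=> us; have <- : [set` [fset x in s]%fset]%classic = [set x | x \in s]%classic.
  by apply/seteqP; split=> x /=; rewrite in_fset.
by apply/card_eq_fsetP; rewrite card_fseq undup_id.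
Qed.

Lemma card_iso_classes (j : k) (s : seq k) : uniq s ->
  (forall y, (y - 16) ^+ 3 = j * y <-> y \in s) ->
  (iso_classes j #= `I_(size s))%card.
Proof.
move=> us sE; rewrite iso_classesE.
apply: card_eq_trans (inj_card_eq (@modulus_class_inj j)) _.
have -> : moduli j = [set y | y \in s]%classic.
  by apply/seteqP; split=> y /sE.
exact: card_seq.
Qed.

End Classification.

(** The discriminant of [(y - 16)^3 - j y] vanishes only for [j = 0] and
    [j = 12^3]. *)
Lemma moduli_double_root (k : fieldType) (k_char0 : [pchar k]%R =i pred0)
    (j a c : k) :
  (forall y, (y - 16) ^+ 3 - j * y = (y - a) ^+ 2 * (y - c)) ->
  j = 0 \/ j = 12 ^+ 3.
Proof.
move=> h; have n0 := nat_neq0 k_char0.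
pose q y := (y - 16) ^+ 3 - j * y - (y - a) ^+ 2 * (y - c).
have q0 y : q y = 0 by rewrite /q h subrr.
have cE : c = 48 - 2 * a.
  apply: (mulfI (n0 1)); apply/eqP; rewrite -subr_eq0; apply/eqP.
  transitivity (q 1 + q (-1) - 2 * q 0); first by rewrite /q; ring.
  by rewrite !q0 mulr0 subr0 addr0.
have jE : j = 768 - a ^+ 2 - 2 * a * c.
  apply: (mulfI (n0 1)); apply/eqP; rewrite -subr_eq0; apply/eqP.
  transitivity (q (-1) - q 1); first by rewrite /q; ring.
  by rewrite !q0 subr0.
have /eqP : 2 * (a + 8) * (a - 16) ^+ 2 = 0.
  transitivity (- q 0); last by rewrite q0 oppr0.
  by rewrite /q cE; ring.
rewrite !mulf_eq0 (negbTE (n0 1)) addr_eq0 orbb subr_eq0 /=.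
by case/orP=> /eqP aE; [right | left]; rewrite jE cE aE; ring.
Qed.

Local Open Scope card_scope.

Theorem theorem4p3 (k : closedFieldType) (k_char0 : [pchar k]%R =i pred0)
    (j : k) :
  [/\ j <> 0 -> j <> 12 ^+ 3 -> iso_classes j #= `I_3,
      j = 0 -> iso_classes j #= `I_1
    & j = 12 ^+ 3 -> iso_classes j #= `I_2].
Proof.
have n0 := nat_neq0 k_char0.
split.
- move=> j0 j1.
  have [y1 e1] := solve_monicpoly (fun i => nth 0
    [:: 4096; j - 768; 48 : k] i) (isT : 0 < 3)%N.
  have [y2 e2] := solve_monicpoly (fun i => nth 0
    [:: j - 768 + 48 * y1 - y1 ^+ 2; 48 - y1] i) (isT : 0 < 2)%N.
  rewrite !big_ord_recl !big_ord0 /= /bump /= in e1 e2.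
  have {}e1 : y1 ^+ 3 = 4096 + (j - 768) * y1 + 48 * y1 ^+ 2 by rewrite e1; ring.
  have {}e2 : y2 ^+ 2 = j - 768 + 48 * y1 - y1 ^+ 2 + (48 - y1) * y2.
    by rewrite e2; ring.
  (* The sum of the roots of the cubic is 48. *)
  pose y3 := 48 - y1 - y2.
  have fE y : (y - 16) ^+ 3 - j * y = (y - y1) * (y - y2) * (y - y3).
    rewrite /y3; ring: e2 e1.
  have y1_root : (y1 - 16) ^+ 3 = j * y1.
    by apply/eqP; rewrite -subr_eq0 fE subrr !mul0r.
  have nd a c : ~ forall y, (y - 16) ^+ 3 - j * y = (y - a) ^+ 2 * (y - c).
    by move=> /(moduli_double_root k_char0)[].
  apply: (card_iso_classes k_char0 (s := [:: y1; y2; y3])).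
    rewrite /= !inE negb_or andbT -andbA; apply/and3P; split; apply/eqP => h.
    + by apply: (nd y1 y3) => y; rewrite fE h; ring.
    + by apply: (nd y1 y2) => y; rewrite fE -h; ring.
    + by apply: (nd y2 y1) => y; rewrite fE -h; ring.
  move=> y; rewrite !inE -!(subr_eq0 y) orbA -!mulf_eq0 -fE subr_eq0.
  by split=> /eqP.
- move=> ->; apply: (card_iso_classes k_char0 (s := [:: 16])) => // y.
  rewrite inE mul0r -subr_eq0; split=> [/eqP|/eqP ->]; last by rewrite expr0n.
  by rewrite expf_eq0.
move=> ->; apply: (card_iso_classes k_char0 (s := [:: - 8; 64])).
  rewrite /= inE andbT; apply/eqP => h; apply: (negP (n0 71)); apply/eqP.
  by transitivity (64 - (- 8) : k); [ring | rewrite h subrr].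
move=> y; rewrite !inE.
have fE : (y - 16) ^+ 3 - 12 ^+ 3 * y = (y + 8) ^+ 2 * (y - 64) by ring.
rewrite -addr_eq0 -(subr_eq0 y 64); split.
  by move=> /eqP; rewrite -subr_eq0 fE mulf_eq0 expf_eq0.
move=> h; apply/eqP; rewrite -subr_eq0 fE mulf_eq0 expf_eq0.
exact: h.
Qed.
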